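(* Let $q\in\mathbb{R}^n$, let $M_0,M_1,\dots,M_L\in\mathbb{R}^{n\times n}$ be positive semidefinite, and for $u\in\mathbb{R}^L$ let $M(u)=M_0+\sum_{l=1}^L u_lM_l$. Let $\mathcal{U}$ be either $\mathcal{U}^r_\infty=\{u\in\mathbb{R}^L:\|u\|_\infty\le 1,\ u\ge 0\}$ or $\mathcal{U}^r_1=\{u\in\mathbb{R}^L:\|u\|_1\le 1,\ u\ge 0\}$. Consider the problem in the variables $(x,t)\in\mathbb{R}^n\times\mathbb{R}$ $$\begin{array}{rl}\min & t\\ \text{subject to} & x^T(M(u)x+q)\le t,\quad\forall u\in\mathcal{U},\\ & M(u)x+q\ge 0,\quad\forall u\in\mathcal{U},\\ & x\ge 0.\end{array}$$ Then this problem has a tractable robust counterpart, which is a (convex) quadratic program (QP) when $\mathcal{U}=\mathcal{U}^r_\infty$ and a (convex) quadratically constrained quadratic program (QCQP) when $\mathcal{U}=\mathcal{U}^r_1$.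
   Context: Vector inequalities are componentwise. Positive semidefinite means $x^TM_lx\ge 0$ for all $x$ (symmetry not required). A tractable robust counterpart of the semi-infinite problem above is a single finite-dimensional convex optimization problem in variables $(x,w)$ or $(x,t,w)$ ($w$ a finite vector of additional variables), with finitely many constraints, that is equivalent to it in the following sense: for every $x$ and $t$, the pair $(x,t)$ is feasible for the semi-infinite problem if and only if there is $w$ such that the corresponding point is feasible for the finite-dimensional problem with objective value at most $t$. A convex QP has a convex quadratic objective and finitely many affine constraints; a convex QCQP has a linear or convex quadratic objective and finitely many affine and convex quadratic inequality constraints. *)

(* Defs.v *)
From mathcomp Require Import all_boot all_order all_algebra.
From mathcomp Require Import all_classical all_reals all_analysis.

Set Implicit Arguments.
Unset Strict Implicit.
Unset Printing Implicit Defensive.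

Import Order.TTheory GRing.Theory Num.Theory.
Import numFieldNormedType.Exports.

Local Open Scope classical_set_scope.
Local Open Scope ring_scope.

Definition dotv (R : realType) (n : nat) (x y : 'cV[R]_n) : R :=
  (x^T *m y) 0 0.

Definition nonneg_vec (R : realType) (n : nat) (x : 'cV[R]_n) : Prop :=
  forall i, 0 <= x i 0.

(* Symmetry is not required. *)
Definition posSemidef (R : realType) (n : nat) (A : 'M[R]_n) : Prop :=
  forall x : 'cV[R]_n, 0 <= dotv x (A *m x).

Definition norm1 (R : realType) (L : nat) (u : 'cV[R]_L) : R :=
  \sum_(l < L) `|u l 0|.

(* `|u| is the library's norm on matrices, the maximum of the `|u l 0|. *)
Definition Uinf (R : realType) (L : nat) : set 'cV[R]_L :=
  [set u | `|u| <= 1 /\ nonneg_vec u].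

Definition U1 (R : realType) (L : nat) : set 'cV[R]_L :=
  [set u | norm1 u <= 1 /\ nonneg_vec u].

Definition uncertain_mx (R : realType) (n L : nat) (M0 : 'M[R]_n)
    (M : 'I_L -> 'M[R]_n) (u : 'cV[R]_L) : 'M[R]_n :=
  M0 + \sum_(l < L) u l 0 *: M l.

Definition semi_infinite_feasible (R : realType) (n L : nat) (q : 'cV[R]_n)
    (M0 : 'M[R]_n) (M : 'I_L -> 'M[R]_n) (U : set 'cV[R]_L)
    (x : 'cV[R]_n) (t : R) : Prop :=
  [/\ forall u, U u -> dotv x (uncertain_mx M0 M u *m x + q) <= t,
      forall u, U u -> nonneg_vec (uncertain_mx M0 M u *m x + q)
    & nonneg_vec x].

Definition affine_function (R : realType) (N : nat) (f : 'cV[R]_N -> R)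
    : Prop :=
  exists (c : 'cV[R]_N) (d : R), forall z, f z = dotv c z + d.

Definition quadratic_function (R : realType) (N : nat) (f : 'cV[R]_N -> R)
    : Prop :=
  exists (Q : 'M[R]_N) (c : 'cV[R]_N) (d : R),
    forall z, f z = dotv z (Q *m z) + dotv c z + d.

Definition convex_quadratic (R : realType) (N : nat) (f : 'cV[R]_N -> R)
    : Prop :=
  quadratic_function f /\ @convex_function R 'cV[R]_N setT f.

(* Minimize objective z subject to constraint i z <= 0 for all i; an equality
   constraint is a pair of opposite inequalities. *)
Record program (R : realType) (N : nat) := Program {
  objective : 'cV[R]_N -> R;
  nconstraints : nat;
  constraint : 'I_nconstraints -> 'cV[R]_N -> R
}.

Definition feasible (R : realType) (N : nat) (P : program R N) (z : 'cV[R]_N)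
    : Prop :=
  forall i, constraint (p := P) i z <= 0.

(* A quadratic function may have a zero quadratic part, so linear objectives
   are covered by convex_quadratic. *)
Definition convexQP (R : realType) (N : nat) (P : program R N) : Prop :=
  convex_quadratic (objective P) /\
  forall i, affine_function (constraint (p := P) i).

Definition convexQCQP (R : realType) (N : nat) (P : program R N) : Prop :=
  convex_quadratic (objective P) /\
  forall i, affine_function (constraint (p := P) i) \/
            convex_quadratic (constraint (p := P) i).

(* A problem "min t s.t. feas x t" has a robust counterpart in the class C of
   programs: a program of class C in the variables (x, w) or (x, t, w), with
   w : 'cV_k, whose feasible points of objective value at most t project onto
   the pairs (x, t) satisfying feas. *)
Definition has_robust_counterpart (R : realType) (n : nat)
    (C : forall N, program R N -> Prop) (feas : 'cV[R]_n -> R -> Prop)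
    : Prop :=
  (exists (k : nat) (P : program R (n + k)),
     C _ P /\
     forall x t, feas x t <->
       exists w : 'cV[R]_k, feasible P (col_mx x w) /\
                            objective P (col_mx x w) <= t)
  \/
  (exists (k : nat) (P : program R (n + (1 + k))),
     C _ P /\
     forall x t, feas x t <->
       exists w : 'cV[R]_k, feasible P (col_mx x (col_mx t%:M w)) /\
                            objective P (col_mx x (col_mx t%:M w)) <= t).

(* Main.v *)
Require Import Defs.
From mathcomp Require Import all_boot all_order all_algebra.
From mathcomp Require Import all_classical all_reals all_analysis.
From mathcomp Require Import ring lra.

(** For fixed [x], both robust constraints bound from above an affine function
    [a + \sum_l u_l b_l] of [u]. Over [Uinf] its maximum is
    [a + \sum_l max(0, b_l)]: in the objective [b_l = x^T M_l x >= 0], so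
    [u = 1] is the worst case, and in the other constraints the positive parts
    are replaced by auxiliary variables bounding them from above. Over [U1] the
    maximum is attained at one of the vertices [0, e_1, ..., e_L], which gives
    one copy of every constraint per vertex. *)

Set Implicit Arguments.
Unset Strict Implicit.
Unset Printing Implicit Defensive.

Import Order.TTheory GRing.Theory Num.Theory.
Import numFieldNormedType.Exports.

Local Open Scope ring_scope.

(** * Bilinearity of [dotv] and the cone of positive semidefinite matrices *)

Lemma dotvE (R : realType) (n : nat) (x y : 'cV[R]_n) :
  dotv x y = \sum_i x i 0 * y i 0.
Proof. by rewrite /dotv mxE; apply: eq_bigr => i _; rewrite mxE. Qed.

Lemma dotvC (R : realType) (n : nat) (x y : 'cV[R]_n) : dotv x y = dotv y x.
Proof. by rewrite !dotvE; apply: eq_bigr => i _; rewrite mulrC. Qed.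

Lemma dotvDr (R : realType) (n : nat) (x y z : 'cV[R]_n) :
  dotv x (y + z) = dotv x y + dotv x z.
Proof. by rewrite /dotv mulmxDr mxE. Qed.

Lemma dotvZr (R : realType) (n : nat) (a : R) (x y : 'cV[R]_n) :
  dotv x (a *: y) = a * dotv x y.
Proof. by rewrite /dotv -scalemxAr mxE. Qed.

Lemma dotvDl (R : realType) (n : nat) (x y z : 'cV[R]_n) :
  dotv (x + y) z = dotv x z + dotv y z.
Proof. by rewrite ![dotv _ z]dotvC dotvDr. Qed.

Lemma dotvZl (R : realType) (n : nat) (a : R) (x y : 'cV[R]_n) :
  dotv (a *: x) y = a * dotv x y.
Proof. by rewrite ![dotv _ y]dotvC dotvZr. Qed.

Lemma dotv0r (R : realType) (n : nat) (x : 'cV[R]_n) : dotv x 0 = 0.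
Proof. by rewrite /dotv mulmx0 mxE. Qed.

Lemma dotv0l (R : realType) (n : nat) (x : 'cV[R]_n) : dotv 0 x = 0.
Proof. by rewrite dotvC dotv0r. Qed.

Lemma dotv_mulmx (R : realType) (m n : nat) (A : 'M[R]_(m, n)) (x : 'cV[R]_m)
    (y : 'cV[R]_n) : dotv x (A *m y) = dotv (A^T *m x) y.
Proof. by rewrite /dotv mulmxA trmx_mul trmxK. Qed.

Lemma dotv_sumr (R : realType) (n : nat) (I : finType) (x : 'cV[R]_n)
    (f : I -> 'cV[R]_n) : dotv x (\sum_i f i) = \sum_i dotv x (f i).
Proof. by rewrite /dotv mulmx_sumr summxE. Qed.

Lemma posSemidefD (R : realType) (n : nat) (A B : 'M[R]_n) :
  posSemidef A -> posSemidef B -> posSemidef (A + B).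
Proof. by move=> hA hB x; rewrite mulmxDl dotvDr addr_ge0. Qed.

Lemma posSemidef0 (R : realType) (n : nat) : posSemidef (0 : 'M[R]_n).
Proof. by move=> x; rewrite mul0mx dotv0r. Qed.

Lemma posSemidef_sum (R : realType) (n : nat) (I : finType) (A : I -> 'M[R]_n) :
  (forall i, posSemidef (A i)) -> posSemidef (\sum_i A i).
Proof.
move=> hA; apply: (big_ind (@posSemidef R n)) => //; first exact: posSemidef0.
exact: posSemidefD.
Qed.

(** * Closure properties of affine functions *)

Lemma affine_cst (R : realType) (N : nat) (a : R) :
  affine_function (fun _ : 'cV[R]_N => a).
Proof. by exists 0, a => z; rewrite dotv0l add0r. Qed.

Lemma affine_coord (R : realType) (N : nat) (i : 'I_N) :
  affine_function (fun z : 'cV[R]_N => z i 0).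
Proof.
exists (delta_mx i 0), 0 => z.
by rewrite /dotv trmx_delta -rowE !mxE addr0.
Qed.

Lemma affineD (R : realType) (N : nat) (f g : 'cV[R]_N -> R) :
  affine_function f -> affine_function g ->
  affine_function (fun z => f z + g z).
Proof.
move=> [c [d hf]] [c' [d' hg]]; exists (c + c'), (d + d') => z.
by rewrite hf hg dotvDl addrACA.
Qed.

Lemma affineZ (R : realType) (N : nat) (a : R) (f : 'cV[R]_N -> R) :
  affine_function f -> affine_function (fun z => a * f z).
Proof.
move=> [c [d hf]]; exists (a *: c), (a * d) => z.
by rewrite hf dotvZl mulrDr.
Qed.

Lemma affineN (R : realType) (N : nat) (f : 'cV[R]_N -> R) :
  affine_function f -> affine_function (fun z => - f z).
Proof.
move=> /(affineZ (-1)) [c [d hf]].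
by exists c, d => z; rewrite -hf mulN1r.
Qed.

Lemma affine_sum (R : realType) (N : nat) (I : finType)
    (f : I -> 'cV[R]_N -> R) :
  (forall i, affine_function (f i)) -> affine_function (fun z => \sum_i f i z).
Proof.
move=> /choice[c /choice[d hf]].
exists (\sum_i c i), (\sum_i d i) => z.
rewrite dotvC dotv_sumr -big_split.
by apply: eq_bigr => i _; rewrite hf dotvC.
Qed.

Lemma affine_mulmx (R : realType) (N m n : nat) (A : 'M[R]_(m, n))
    (f : 'cV[R]_N -> 'cV[R]_n) (i : 'I_m) :
  (forall j, affine_function (fun z => f z j 0)) ->
  affine_function (fun z => (A *m f z) i 0).
Proof.
move=> hf; have [c [d h]] := affine_sum (fun j => affineZ (A i j) (hf j)).
by exists c, d => z; rewrite -h mxE.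
Qed.

Lemma affine_usubmx (R : realType) (m k : nat) (i : 'I_m) :
  affine_function (fun z : 'cV[R]_(m + k) => usubmx z i 0).
Proof.
have [c [d h]] := affine_coord R (lshift k i).
by exists c, d => z; rewrite -h mxE.
Qed.

Lemma affine_dsubmx (R : realType) (m k : nat) (i : 'I_k) :
  affine_function (fun z : 'cV[R]_(m + k) => dsubmx z i 0).
Proof.
have [c [d h]] := affine_coord R (rshift m i).
by exists c, d => z; rewrite -h mxE.
Qed.

(** * Convex quadratic functions *)

Lemma affine_convex_quadratic (R : realType) (N : nat) (f : 'cV[R]_N -> R) :
  affine_function f -> convex_quadratic f.
Proof.
move=> [c [d hf]]; split.
  by exists 0, c, d => z; rewrite hf mul0mx dotv0r add0r.
move=> t x y _ _; rewrite convRE !hf /conv /= dotvDr !dotvZr /unstable.onem.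
by lra.
Qed.

Lemma convex_quadraticD (R : realType) (N : nat) (f g : 'cV[R]_N -> R) :
  convex_quadratic f -> convex_quadratic g ->
  convex_quadratic (fun z => f z + g z).
Proof.
move=> [[Q [c [d hf]]] cf] [[Q' [c' [d' hg]]] cg]; split.
  exists (Q + Q'), (c + c'), (d + d') => z.
  by rewrite hf hg mulmxDl dotvDr dotvDl; ring.
move=> t x y xD yD; have := lerD (cf t x y xD yD) (cg t x y xD yD).
by move/le_trans; apply; rewrite !convRE; lra.
Qed.

(* The convexity defect of the quadratic form at [t x + (1 - t) y] is
   [t (1 - t)] times its value at [x - y]. *)
Lemma posSemidef_convex_quadratic (R : realType) (N : nat) (A : 'M[R]_N) :
  posSemidef A -> convex_quadratic (fun z : 'cV[R]_N => dotv z (A *m z)).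
Proof.
move=> hA; split.
  by exists A, 0, 0 => z; rewrite dotv0l !addr0.
move=> t x y _ _; rewrite convRE /conv /= /unstable.onem -subr_ge0.
rewrite mulmxDr -!scalemxAr !dotvDl !dotvDr !dotvZl !dotvZr.
have := hA (x - y); rewrite -[- y]scaleN1r mulmxDr -scalemxAr.
rewrite !dotvDl !dotvDr !dotvZl !dotvZr.
have t0 : 0 <= t%:num by [].
have t1 : 0 <= 1 - t%:num by rewrite subr_ge0.
move=> h; apply: le_trans (mulr_ge0 (mulr_ge0 t0 t1) h) _.
by lra.
Qed.

(** A convex quadratic in [x] stays one in the joint variable [z = (x, w)]: it is pulled back along
    the projection [B = [I 0]], and the form of [B^T A B] at [z] is that of [A] at [B z], hence
    nonnegative. *)
Lemma convex_quadratic_usubmx (R : realType) (n k : nat) (A : 'M[R]_n)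
    (q : 'cV[R]_n) :
  posSemidef A ->
  convex_quadratic
    (fun z : 'cV[R]_(n + k) => dotv (usubmx z) (A *m usubmx z + q)).
Proof.
move=> hA; pose B : 'M[R]_(n, n + k) := row_mx 1%:M 0.
have hB (z : 'cV[R]_(n + k)) : B *m z = usubmx z.
  by rewrite -{1}(vsubmxK z) mul_row_col mul1mx mul0mx addr0.
have hBAB : posSemidef (B^T *m A *m B).
  by move=> z; rewrite -!mulmxA dotv_mulmx trmxK hB.
have -> : (fun z => dotv (usubmx z) (A *m usubmx z + q)) =
    (fun z => dotv z (B^T *m A *m B *m z) + dotv (B^T *m q) z).
  apply/funext => z.
  by rewrite -!mulmxA dotv_mulmx -dotv_mulmx [in RHS]dotv_mulmx trmxK hB dotvDr
    [dotv _ z]dotvC [dotv z _]dotv_mulmx trmxK hB.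
apply: convex_quadraticD; first exact: posSemidef_convex_quadratic.
apply: affine_convex_quadratic; exists (B^T *m q), 0 => z.
by rewrite addr0.
Qed.

(** Indexing by any finite type lets sums and products of index types name the families of
    constraints; the enumeration of [I] turns them into a numbered list. *)
Definition fin_program (R : realType) (N : nat) (f : 'cV[R]_N -> R)
    (I : finType) (g : I -> 'cV[R]_N -> R) : program R N :=
  Program f (fun i : 'I_#|I| => g (enum_val i)).

Lemma feasible_fin_program (R : realType) (N : nat) (f : 'cV[R]_N -> R)
    (I : finType) (g : I -> 'cV[R]_N -> R) (z : 'cV[R]_N) :
  feasible (fin_program f g) z <-> forall i, g i z <= 0.
Proof.
split=> [h i|h i]; last exact: h.
by have := h (enum_rank i); rewrite /= enum_rankK.
Qed.

(** * Robust affine inequalities over [Uinf] and [U1] *)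

Lemma UinfE (R : realType) (L : nat) (u : 'cV[R]_L) :
  Uinf u <-> forall l, 0 <= u l 0 <= 1.
Proof.
rewrite /Uinf /= /Num.norm /= mx_normrE; split.
  move=> [/bigmax_leP[_ h1] h0] l.
  by rewrite h0 (le_trans (ler_norm _)) ?(h1 (l, 0)).
move=> h; split; last by move=> l; case/andP: (h l).
apply/bigmax_leP; split=> // -[l j] _ /=.
by rewrite (ord1 j); case/andP: (h l) => /ger0_norm ->.
Qed.

(* The slack [s] stands for the positive part of [b]. *)
Lemma Uinf_affine_le0 (R : realType) (L : nat) (a : R) (b : 'I_L -> R) :
  (forall u, Uinf u -> a + \sum_l u l 0 * b l <= 0) <->
  exists s : 'I_L -> R,
    [/\ forall l, 0 <= s l, forall l, b l <= s l & a + \sum_l s l <= 0].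
Proof.
split=> [h|[s [s0 bs has]] u /UinfE hu].
  exists (fun l => Num.max 0 (b l)); split=> [l|l|].
  - by rewrite le_max lexx.
  - by rewrite le_max lexx orbT.
  (* The worst case is the indicator of the nonnegative [b l]: it turns each [u l 0 * b l] into
     [Num.max 0 (b l)]. *)
  - pose u : 'cV[R]_L := \col_l (0 <= b l)%R%:R.
    have Uu : Uinf u by apply/UinfE => l; rewrite mxE ler0n lern1 leq_b1.
    apply: le_trans _ (h u Uu); rewrite lerD2l; apply: ler_sum => l _.
    by rewrite mxE; case: (leP 0 (b l)) => _; rewrite ?mul1r ?mul0r.
apply: le_trans has; rewrite lerD2l; apply: ler_sum => l _.
have /andP[u0 u1] := hu l.
(* Termwise, [u_l b_l <= u_l s_l <= s_l], from [0 <= u_l] and then from [u_l <= 1] with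
   [0 <= s_l]. *)
apply: le_trans (ler_wpM2l u0 (bs l)) _.
by rewrite -[leRHS]mul1r ler_wpM2r.
Qed.

(** Each [u] in [U1] is the convex combination of the vertices [0] and [e_l] with weights
    [1 - \sum_l u_l] and [u_l], so the affine function at [u] is the same average of its vertex
    values. [None] stands for the vertex [0]. *)
Lemma U1_affine_le0 (R : realType) (L : nat) (a : R) (b : 'I_L -> R) :
  (forall u, U1 u -> a + \sum_l u l 0 * b l <= 0) <->
  forall o : option 'I_L, a + oapp b 0 o <= 0.
Proof.
split=> [h [l|]|h u [hu u0]] /=.
- have := h (delta_mx l 0).
  rewrite (bigD1 l) //= big1 => [|k /negPf kl]; last by rewrite !mxE kl mul0r.
  rewrite mxE !eqxx mul1r addr0; apply; split; last first.
    by move=> k; rewrite mxE ler0n.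
  rewrite /norm1 (bigD1 l) //= big1 => [|k /negPf kl].
    by rewrite mxE !eqxx addr0 normr1.
  by rewrite mxE kl normr0.
- have := h 0; rewrite big1 => [|l _]; last by rewrite mxE mul0r.
  apply; split; last by move=> l; rewrite mxE.
  by rewrite /norm1 big1 // => l _; rewrite mxE normr0.
have su : \sum_l u l 0 <= 1.
  apply: le_trans hu; rewrite le_eqVlt; apply/orP; left; apply/eqP.
  by apply: eq_bigr => l _; rewrite ger0_norm.
have -> : a + \sum_l u l 0 * b l =
    (1 - \sum_l u l 0) * a + \sum_l u l 0 * (a + b l).
  have -> : \sum_l u l 0 * (a + b l) =
      (\sum_l u l 0) * a + \sum_l u l 0 * b l.
    by rewrite mulr_suml -big_split; apply: eq_bigr => l _; rewrite mulrDr.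
  by ring.
have a0 : a <= 0 by have := h None; rewrite addr0.
rewrite -[leRHS]addr0; apply: lerD; first by rewrite mulr_ge0_le0 ?subr_ge0.
by apply: sumr_le0 => l _; rewrite mulr_ge0_le0 // (h (Some l)).
Qed.

(** * The semi-infinite problem as robust affine inequalities in [u] *)

Lemma uncertain_objectiveE (R : realType) (n L : nat) (q : 'cV[R]_n)
    (M0 : 'M[R]_n) (M : 'I_L -> 'M[R]_n) (x : 'cV[R]_n) (u : 'cV[R]_L) :
  dotv x (uncertain_mx M0 M u *m x + q) =
  dotv x (M0 *m x + q) + \sum_l u l 0 * dotv x (M l *m x).
Proof.
rewrite /uncertain_mx mulmxDl mulmx_suml !dotvDr dotv_sumr addrAC.
by under eq_bigr do rewrite -scalemxAl dotvZr.
Qed.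

Lemma uncertain_rowE (R : realType) (n L : nat) (q : 'cV[R]_n)
    (M0 : 'M[R]_n) (M : 'I_L -> 'M[R]_n) (x : 'cV[R]_n) (u : 'cV[R]_L)
    (i : 'I_n) :
  (uncertain_mx M0 M u *m x + q) i 0 =
  (M0 *m x + q) i 0 + \sum_l u l 0 * (M l *m x) i 0.
Proof.
rewrite /uncertain_mx mulmxDl mulmx_suml mxE [in LHS]mxE [in RHS]mxE summxE addrAC.
by under eq_bigr do rewrite -scalemxAl mxE.
Qed.

(** This brings every robust constraint to the form [a + \sum_l u_l b_l <= 0]; the index [i] is
    quantified before [u], so that each row is a separate robust inequality with its own slacks or
    vertices. *)
Lemma semi_infinite_feasibleE (R : realType) (n L : nat) (q : 'cV[R]_n)
    (M0 : 'M[R]_n) (M : 'I_L -> 'M[R]_n) (U : set 'cV[R]_L) x t :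
  semi_infinite_feasible q M0 M U x t <->
  [/\ forall u, U u -> dotv x (M0 *m x + q) - t
                       + \sum_l u l 0 * dotv x (M l *m x) <= 0,
      forall i u, U u -> - (M0 *m x + q) i 0
                         + \sum_l u l 0 * - (M l *m x) i 0 <= 0
    & nonneg_vec x].
Proof.
have rowE i u : \sum_l u l 0 * - (M l *m x) i 0 =
    - \sum_l u l 0 * (M l *m x) i 0.
  by rewrite -sumrN; apply: eq_bigr => l _; rewrite mulrN.
split=> -[h1 h2 h3].
  split=> // [u Uu|i u Uu].
    by have := h1 u Uu; rewrite uncertain_objectiveE; lra.
  by have := h2 u Uu i; rewrite uncertain_rowE rowE; lra.
split=> // u Uu; first by have := h1 u Uu; rewrite uncertain_objectiveE; lra.
by move=> i; have := h2 i u Uu; rewrite uncertain_rowE rowE; lra.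
Qed.

(** * Counterpart over [Uinf]: a convex QP *)

Lemma robust_counterpart_Uinf (R : realType) (n L : nat) (q : 'cV[R]_n)
    (M0 : 'M[R]_n) (M : 'I_L -> 'M[R]_n) :
  posSemidef M0 -> (forall l, posSemidef (M l)) ->
  has_robust_counterpart (@convexQP R)
    (semi_infinite_feasible q M0 M (@Uinf R L)).
Proof.
(* Since [u = 1] is worst for the objective at every [x], the worst-case value is one convex
   quadratic and serves as the objective itself. Without [t], all constraints stay affine. *)
move=> hM0 hM; left; pose N := (n + n * L)%N.
(* There is one slack for each row [i] and each [l]; they form an [n] by [L] matrix flattened into
   [w]. *)
pose slack (z : 'cV[R]_N) i l := dsubmx z (mxvec_index i l) 0.
pose g (c : 'I_n + 'I_n + ('I_n * 'I_L + 'I_n * 'I_L)) (z : 'cV[R]_N) :=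
  match c with
  | inl (inl i) => - usubmx z i 0
  | inl (inr i) => - (M0 *m usubmx z + q) i 0 + \sum_l slack z i l
  | inr (inl (i, l)) => - slack z i l
  | inr (inr (i, l)) => - (M l *m usubmx z) i 0 - slack z i l
  end.
exists (n * L)%N,
  (fin_program (fun z => dotv (usubmx z) ((M0 + \sum_l M l) *m usubmx z + q)) g).
split.
  split; first exact/convex_quadratic_usubmx/posSemidefD/posSemidef_sum.
  move=> k; rewrite /= /g.
  case: (enum_val k) => [[i|i]|[[i l]|[i l]]].
  - exact/affineN/affine_usubmx.
  - apply: affineD; last by apply: affine_sum => l; exact: affine_dsubmx.
    under eq_fun do rewrite mxE.
    apply: affineN; apply: affineD; last exact: affine_cst.
    by apply: affine_mulmx => j; exact: affine_usubmx.
  - exact/affineN/affine_dsubmx.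
  - apply: affineD; apply: affineN; last exact: affine_dsubmx.
    by apply: affine_mulmx => j; exact: affine_usubmx.
(* Semidefiniteness makes [x^T M_l x] nonnegative, hence itself an admissible slack, and the
   smallest one. *)
have objE x t : (forall u : 'cV[R]_L, Uinf u ->
      dotv x (M0 *m x + q) - t + \sum_l u l 0 * dotv x (M l *m x) <= 0) <->
    dotv x ((M0 + \sum_l M l) *m x + q) <= t.
  have -> : dotv x ((M0 + \sum_l M l) *m x + q) =
      dotv x (M0 *m x + q) + \sum_l dotv x (M l *m x).
    by rewrite mulmxDl mulmx_suml !dotvDr dotv_sumr addrAC.
  rewrite Uinf_affine_le0; split=> [[s [_ hs]]|h].
    have : \sum_l dotv x (M l *m x) <= \sum_l s l by apply: ler_sum.
    lra.
  exists (fun l => dotv x (M l *m x)); split=> //; first by move=> l; exact: hM.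
  by move: h; lra.
move=> x t; rewrite semi_infinite_feasibleE; split.
  move=> [/objE h1 h2 x0].
  (* The slack vectors chosen row by row are assembled into the matrix encoded by [w]. *)
  have /choice[s hs] := fun i => (Uinf_affine_le0 _ _).1 (h2 i).
  exists (mxvec (\matrix_(i, l) s i l))^T.
  rewrite feasible_fin_program /= /g /slack col_mxKu col_mxKd; split=> //.
  have sE i l : (mxvec (\matrix_(i, l) s i l))^T (mxvec_index i l) 0 = s i l.
    by rewrite mxE mxvecE mxE.
  case=> [[i|i]|[[i l]|[i l]]]; have [s0 sb sa] := hs i; rewrite ?sE.
  - by rewrite oppr_le0.
  - by under eq_bigr do rewrite sE.
  - by rewrite oppr_le0.
  - by rewrite subr_le0.
move=> [w]; rewrite feasible_fin_program /= col_mxKu => -[hg hobj].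
split; first exact/objE.
- move=> i; apply/Uinf_affine_le0; exists (slack (col_mx x w) i); split=> [l|l|].
  + by have := hg (inr (inl (i, l))); rewrite /= oppr_le0.
  + by have := hg (inr (inr (i, l))); rewrite /= col_mxKu subr_le0.
  + by have := hg (inl (inr i)); rewrite /= col_mxKu.
- by move=> i; have := hg (inl (inl i)); rewrite /= col_mxKu oppr_le0.
Qed.

(** * Counterpart over [U1]: a convex QCQP *)

Lemma robust_counterpart_U1 (R : realType) (n L : nat) (q : 'cV[R]_n)
    (M0 : 'M[R]_n) (M : 'I_L -> 'M[R]_n) :
  posSemidef M0 -> (forall l, posSemidef (M l)) ->
  has_robust_counterpart (@convexQCQP R)
    (semi_infinite_feasible q M0 M (@U1 R L)).
Proof.
(* The worst-case objective is now a maximum of [L + 1] convex quadratics, so [t] is kept as an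
   epigraph variable and each of them gives a constraint. The auxiliary vector [w] is empty. *)
move=> hM0 hM; right; pose N := (n + (1 + 0))%N.
(* [A o] is the uncertain matrix at the vertex [o]. *)
pose A (o : option 'I_L) := M0 + oapp M 0 o.
have hA o : posSemidef (A o).
  by apply: posSemidefD => //; case: o => [l|] /=; [exact: hM|exact: posSemidef0].
pose tv (z : 'cV[R]_N) := usubmx (dsubmx z) 0 0.
have tvK x t w : tv (col_mx x (col_mx t%:M w)) = t.
  by rewrite /tv col_mxKd col_mxKu mxE.
have affine_tv : affine_function tv.
  have [c [d h]] := affine_dsubmx R n (lshift 0 (0 : 'I_1)).
  by exists c, d => z; rewrite -h /tv mxE.
pose g (c : 'I_n + (option 'I_L + option 'I_L * 'I_n)) (z : 'cV[R]_N) :=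
  match c with
  | inl i => - usubmx z i 0
  | inr (inl o) => dotv (usubmx z) (A o *m usubmx z + q) - tv z
  | inr (inr (o, i)) => - (A o *m usubmx z + q) i 0
  end.
exists 0%N, (fin_program tv g); split.
  split; first exact: affine_convex_quadratic.
  move=> k; rewrite /= /g; case: (enum_val k) => [i|[v|[v i]]].
  - left; exact/affineN/affine_usubmx.
  - right; apply: convex_quadraticD; first exact: convex_quadratic_usubmx.
    exact/affine_convex_quadratic/affineN.
  - left; under eq_fun do rewrite mxE.
    apply: affineN; apply: affineD; last exact: affine_cst.
    by apply: affine_mulmx => j; exact: affine_usubmx.
have objE x t o : dotv x (A o *m x + q) - t =
    dotv x (M0 *m x + q) - t + oapp (fun l => dotv x (M l *m x)) 0 o.
  case: o => [l|]; rewrite /A /= ?addr0 //.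
  by rewrite mulmxDl !dotvDr; ring.
have rowE x i o : - (A o *m x + q) i 0 =
    - (M0 *m x + q) i 0 + oapp (fun l => - (M l *m x) i 0) 0 o.
  case: o => [l|]; rewrite /A /= ?addr0 //.
  by rewrite mulmxDl !mxE; ring.
move=> x t; rewrite semi_infinite_feasibleE; split.
  (* The witness is the empty vector, and the objective condition reads [t <= t]. *)
  move=> [/U1_affine_le0 h1 h2 x0]; exists 0.
  rewrite feasible_fin_program /= tvK; split=> //.
  case=> [i|[v|[v i]]] /=; rewrite ?tvK col_mxKu.
  - by rewrite oppr_le0.
  - by rewrite objE.
  - by rewrite rowE; move: v; apply/U1_affine_le0/h2.
move=> [w]; rewrite feasible_fin_program => -[hg _]; split.
- by apply/U1_affine_le0 => o; have := hg (inr (inl o)); rewrite /= tvK col_mxKu objE.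
- move=> i; apply/U1_affine_le0 => o.
  by have := hg (inr (inr (o, i))); rewrite /= col_mxKu rowE.
- by move=> i; have := hg (inl i); rewrite /= col_mxKu oppr_le0.
Qed.

Theorem proposition3p4 (R : realType) (n L : nat) (q : 'cV[R]_n)
    (M0 : 'M[R]_n) (M : 'I_L -> 'M[R]_n)
    (hM0 : posSemidef M0) (hM : forall l, posSemidef (M l)) :
  has_robust_counterpart (@convexQP R)
    (semi_infinite_feasible q M0 M (@Uinf R L)) /\
  has_robust_counterpart (@convexQCQP R)
    (semi_infinite_feasible q M0 M (@U1 R L)).
Proof.
by split; [exact: robust_counterpart_Uinf | exact: robust_counterpart_U1].
Qed.
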